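(* Let $G$ be a connected regular graph of order $n$ and diameter $D$, and let $H$ be a proper subgraph of $G$. Then $$\mu(G)-\mu(H)>\frac{1}{n(D+1)}.$$
   Context: Graphs are finite, simple and undirected, with nonempty vertex set; the order of a graph is its number of vertices. $\mu(G)$ denotes the largest eigenvalue of the adjacency matrix of $G$. A proper subgraph of $G$ is a subgraph different from $G$ (it may have fewer vertices, or the same vertices and fewer edges, and need not be connected). The diameter is the maximum over pairs of vertices of the length of a shortest path joining them. *)

(* Defs.v *)
From mathcomp Require Import all_boot all_order all_algebra.
From mathcomp Require Import polyrcf complex.
Set Implicit Arguments.
Unset Strict Implicit.
Unset Printing Implicit Defensive.
Import Order.TTheory GRing.Theory Num.Theory.
Local Open Scope ring_scope.

(* Graphs live in an ambient finite type so that subgraphs have the same type;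
   taking the whole of [U] as vertex set covers every finite simple graph.
   An edge is a two-element set of vertices. *)
Record graph (U : finType) := Graph {
  vertices : {set U};
  edges : {set {set U}};
  vertices_neq0 : vertices != set0;
  edgesP : [forall e in edges, (#|e| == 2) && (e \subset vertices)] }.

Definition graph_order (U : finType) (G : graph U) : nat := #|vertices G|.

Definition adj (U : finType) (G : graph U) : rel U :=
  [rel x y | [set x; y] \in edges G].

Definition subgraph (U : finType) (H G : graph U) : bool :=
  (vertices H \subset vertices G) && (edges H \subset edges G).

Definition proper_subgraph (U : finType) (H G : graph U) : bool :=
  subgraph H G && ((vertices H != vertices G) || (edges H != edges G)).

Definition degree (U : finType) (G : graph U) (x : U) : nat :=
  #|[set y | adj G x y]|.

Definition regular (U : finType) (G : graph U) : Prop :=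
  exists k, forall x, x \in vertices G -> degree G x = k.

(* [x :: p] is a path (without repeated vertex) of length [k] from x to y. *)
Definition has_path (U : finType) (G : graph U) (x y : U) (k : nat) : bool :=
  [exists p : k.-tuple U,
    [&& path (adj G) x p, last x p == y & uniq (x :: p)]].

Definition connected (U : finType) (G : graph U) : Prop :=
  forall x y, x \in vertices G -> y \in vertices G ->
    exists k, has_path G x y k.

(* Least length of a path from x to y.  Paths have length less than [#|U|],
   which serves as the default value when there is no path at all. *)
Definition dist (U : finType) (G : graph U) (x y : U) : nat :=
  find (has_path G x y) (iota 0 #|U|).

Definition diameter (U : finType) (G : graph U) : nat :=
  \max_(x in vertices G) \max_(y in vertices G) dist G x y.

Definition adjmx (R : pzSemiRingType) (U : finType) (G : graph U) :
    'M[R]_(graph_order G) :=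
  \matrix_(i, j) (adj G (enum_val i) (enum_val j))%:R.

(* The real numbers are taken to be any real closed field, which is all that is
   needed for real symmetric matrices to have real eigenvalues.
   [rootsR p] lists the roots of p in increasing order, so for a matrix that
   has an eigenvalue this is the largest one. *)
Definition largest_eigenvalue (R : rcfType) (n : nat) (A : 'M[R]_n) : R :=
  last 0 (rootsR (char_poly A)).

Definition mu (R : rcfType) (U : finType) (G : graph U) : R :=
  largest_eigenvalue (adjmx R G).
Arguments mu R {U} G.

Lemma dist_correct (U : finType) (G : graph U) (x y : U) k :
  has_path G x y k -> has_path G x y (dist G x y) /\ (dist G x y <= k)%N.
Proof.
move=> xyk; have kU : (k < #|U|)%N.
  case/existsP: xyk => p /and3P[_ _ /card_uniqP]; rewrite /= size_tuple => <-.
  exact: max_card.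
have hasP : has (has_path G x y) (iota 0 #|U|).
  by apply/hasP; exists k; rewrite ?mem_iota.
have := nth_find 0 hasP; have := hasP; rewrite has_find size_iota => ltf.
rewrite nth_iota // add0n; split=> //; rewrite leqNgt; apply/negP => ltk.
by have := before_find 0 ltk; rewrite nth_iota // add0n xyk.
Qed.

Lemma symmetric_has_eigenvalue (R : rcfType) n (A : 'M[R]_n) :
  (0 < n)%N -> A^T = A -> exists a, eigenvalue A a.
Proof.
case: n A => // n A _ symA; pose B := map_mx (real_complex R) A.
have hB : B \is hermsymmx.
  apply: realsym_hermsym.
    by apply/is_hermitianmxP; rewrite expr0 scale1r map_mx_id // map_trmx symA.
  by apply/mxOverP => i j; rewrite !mxE complex_real.
have /complex_realP[a aE] : spectral_diag B 0 0 \is Num.real.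
  by have /mxOverP := hermitian_spectral_diag_real hB; apply.
exists a; rewrite -(eigenvalue_map (real_complex R)) /= -/B -aE.
have /hermitian_normalmx/orthomx_spectralP BE := hB.
have uP := spectral_unit B.
apply/eigenvalueP; exists (row 0 (spectralmx B)); last first.
  apply/eqP => P0; have := uP; rewrite -row_free_unit => /row_freeP[C PC].
  have /rowP/(_ 0) : row 0 (spectralmx B *m C) = 0 by rewrite row_mul P0 mul0mx.
  by rewrite PC !mxE eqxx => /eqP; rewrite oner_eq0.
rewrite -row_mul [X in _ *m X]BE !mulmxA mulmxV // mul1mx.
by rewrite row_mul row_diag_mx -scalemxAl -rowE.
Qed.

Lemma largest_eigenvalueP (R : rcfType) n (A : 'M[R]_n) a :
  eigenvalue A a ->
  eigenvalue A (largest_eigenvalue A) /\ a <= largest_eigenvalue A.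
Proof.
have p0 : char_poly A != 0 by rewrite monic_neq0 ?char_poly_monic.
have rootsE x : (x \in rootsR (char_poly A)) = eigenvalue A x.
  by rewrite eigenvalue_root_char -(roots_on_rootsR p0) in_itv.
have := sorted_roots (- cauchy_bound (char_poly A))
  (cauchy_bound (char_poly A)) (char_poly A).
rewrite -!rootsE /largest_eigenvalue -/(rootsR _).
case/lastP: (rootsR _) => // s x; rewrite last_rcons mem_rcons inE => srt.
move=> ax; split; first by rewrite mem_rcons mem_head.
move: ax; case/orP => [/eqP-> //|ain].
have := srt; rewrite -cats1 lt_sorted_pairwise pairwise_cat => /andP[+ _].
by rewrite allrel1r => /allP/(_ _ ain)/ltW.
Qed.

Lemma mu_correct (R : rcfType) (U : finType) (G : graph U) :
  eigenvalue (adjmx R G) (mu R G) /\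
  (forall a, eigenvalue (adjmx R G) a -> a <= mu R G).
Proof.
have [||a /largest_eigenvalueP[mu_eig _]] := @symmetric_has_eigenvalue R _ (adjmx R G).
- by rewrite card_gt0 vertices_neq0.
- by apply/matrixP => i j; rewrite !mxE /adj /= setUC.
by split=> // b /largest_eigenvalueP[].
Qed.

(* Main.v *)
Require Import Defs.
From mathcomp Require Import all_boot all_order all_algebra.
From mathcomp Require Import ring lra.
Import Order.TTheory GRing.Theory Num.Theory.
Local Open Scope ring_scope.

(** Let [k] be the degree of [G], so that [k <= mu G] (the all-ones vector is an
    eigenvector).  Since [G] is connected, some edge [e = zz'] of [G] is missing
    from [H].  Let [f >= 0] be the entrywise absolute value of an eigenvector of
    [H] for [mu H], extended by zero to all vertices, and let [S] be the sum of
    the [f a ^+ 2].  Then [mu H * S] is at most the quadratic form of [G - e]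
    at [f], and completing squares gives
      [(k - mu H) * S >= E + f z ^+ 2 + f z' ^+ 2],
    where [E] is the sum of [(f a - f b) ^+ 2] over the edges [ab] of [G - e]
    (lemma [energy_delete_edge]).

    Now let [w] maximise [f].  A path of [G] from [w] to an end of [e], of length
    at most the diameter [D], can be cut where it first meets [e]
    (lemma [path_cut_at_edge]); it then avoids the edge [e] and ends at, say,
    [z].  By Cauchy-Schwarz along this path (lemma [sqr_le_path_energy]),
      [f w ^+ 2 <= (D + 1) * (E + f z ^+ 2)].
    Hence [(k - mu H) * S * (D + 1) >= f w ^+ 2 + (D + 1) * f z' ^+ 2], and
    [S <= n * f w ^+ 2].  One of these two estimates leaves room: if [f z' = 0]
    then [z'] contributes nothing to [S], and otherwise the term [f z' ^+ 2] is
    positive.  Therefore [(k - mu H) * n * (D + 1) > 1]. *)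

(** * Energy along a path *)

Fixpoint path_energy {R : realFieldType} {U : Type} (f : U -> R) (x : U)
    (p : seq U) : R :=
  if p is y :: p' then (f x - f y) ^+ 2 + path_energy f y p' else 0.

(** Cauchy-Schwarz for the telescoping sum that writes [f x] as the value at the
    end of the path plus the increments. *)
Lemma sqr_le_path_energy {R : realFieldType} {U : Type} (f : U -> R) x p :
  f x ^+ 2 <= (size p).+1%:R * (path_energy f x p + f (last x p) ^+ 2).
Proof.
elim: p x => [|y p IH] x /=; first by rewrite mul1r add0r.
have := IH y; rewrite -[(size p).+2%:R]natr1.
have : 0 < (size p).+1%:R :> R by rewrite ltr0n.
move: (size p).+1%:R (path_energy f y p) (f (last y p)) => m P l m0 Hy.
rewrite -(ler_pM2l m0) -subr_ge0.
(* With [m] the number of vertices after [x], both sides times [m] differ by this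
   square plus [(m + 1) * (B - f y ^+ 2)], where [B = m * (P + l ^+ 2)] is the
   induction bound. *)
have /le_trans -> // : 0 <= (m * (f x - f y) - f y) ^+ 2 by exact: sqr_ge0.
rewrite -subr_ge0.
have -> : m * ((m + 1) * ((f x - f y) ^+ 2 + P + l ^+ 2)) - m * f x ^+ 2 -
    (m * (f x - f y) - f y) ^+ 2 = (m + 1) * (m * (P + l ^+ 2) - f y ^+ 2).
  by ring.
by rewrite mulr_ge0 ?subr_ge0 // addr_ge0 // ltW.
Qed.

(** Each step of the path is counted in the double sum in both directions. *)
Lemma path_energy_le_seq {R : realFieldType} {U : Type} (e : rel U)
    (f : U -> R) x p :
  symmetric e -> path e x p ->
  path_energy f x p *+ 2 <=
    \sum_(a <- x :: p) \sum_(b <- x :: p) (e a b)%:R * (f a - f b) ^+ 2.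
Proof.
move=> sym_e; have c_ge0 a b : 0 <= (e a b)%:R * (f a - f b) ^+ 2.
  by rewrite mulr_ge0 ?ler0n ?sqr_ge0.
(* Peel off row and column [x] of the double sum: they contain the terms of the
   step from [x] to [y], and the remaining block is the induction hypothesis. *)
elim: p x => [|y p IH] x /=; first by rewrite mul0rn !big_seq1.
case/andP=> exy /IH {}IH.
pose c a b := (e a b)%:R * (f a - f b) ^+ 2.
have -> (s : seq U) : \sum_(a <- x :: s) \sum_(b <- x :: s) c a b =
    c x x + \sum_(b <- s) c x b +
    (\sum_(a <- s) c a x + \sum_(a <- s) \sum_(b <- s) c a b).
  rewrite !big_cons -big_split /=; congr (_ + _).
  by apply: eq_bigr => a _; rewrite big_cons.
rewrite addrA mulrnDl lerD //.
rewrite [\sum_(b <- _) c x b]big_cons [\sum_(a <- _) c a x]big_cons.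
have -> : c x y = (f x - f y) ^+ 2 by rewrite /c exy mul1r.
have -> : c y x = (f x - f y) ^+ 2 by rewrite /c sym_e exy mul1r -sqrrN opprB.
have := sumr_ge0 _ (fun b (_ : true) => c_ge0 x b) : 0 <= \sum_(b <- p) c x b.
have := sumr_ge0 _ (fun a (_ : true) => c_ge0 a x) : 0 <= \sum_(a <- p) c a x.
have := c_ge0 x x; rewrite -/(c x x) mulr2n.
lra.
Qed.

(** Along a path without repeated vertex, distinct steps are distinct edges. *)
Lemma path_energy_le {R : realFieldType} {U : finType} (e : rel U)
    (f : U -> R) x p :
  symmetric e -> path e x p -> uniq (x :: p) ->
  path_energy f x p *+ 2 <= \sum_a \sum_b (e a b)%:R * (f a - f b) ^+ 2.
Proof.
move=> sym_e exp up; apply: le_trans (path_energy_le_seq e f x p sym_e exp) _.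
have c_ge0 a b : 0 <= (e a b)%:R * (f a - f b) ^+ 2.
  by rewrite mulr_ge0 ?ler0n ?sqr_ge0.
have sub (F : U -> R) : (forall a, 0 <= F a) ->
    \sum_(a <- x :: p) F a <= \sum_a F a.
  move=> F0; rewrite big_uniq //= [leRHS](bigID (mem (x :: p))) /=.
  by rewrite lerDl sumr_ge0.
apply: le_trans (sub _ _) => [|a]; last exact: sumr_ge0.
by apply: ler_sum => a _; apply: sub.
Qed.

(** * Deleting an edge *)

Definition delete_edge {U : finType} (e : rel U) (d : {set U}) : rel U :=
  [rel a b | e a b && ([set a; b] != d)].

Lemma delete_edge_sym {U : finType} (e : rel U) d :
  symmetric e -> symmetric (delete_edge e d).
Proof. by move=> sym_e a b; rewrite /delete_edge /= sym_e setUC. Qed.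

(** Before its first visit to [d], a path cannot use [d] as an edge. *)
Lemma path_cut_at_edge {U : finType} (e : rel U) (d : {set U}) x p :
  path e x p -> last x p \in d ->
  exists q, [/\ prefix q p, path (delete_edge e d) x q & last x q \in d].
Proof.
elim: p x => [|y p IH] x /=; first by exists [::].
case/andP=> exy eyp ld; have [xd|xNd] := boolP (x \in d).
  by exists [::].
have [q [qp eq lq]] := IH y eyp ld.
exists (y :: q); split=> //=; first by rewrite eqxx.
rewrite eq andbT /delete_edge /= exy; apply: contraNneq xNd => <-.
by rewrite set21.
Qed.

Lemma set2_eq {U : finType} (a b z z' : U) : z != z' ->
  ([set a; b] == [set z; z']) =
    ((a == z) && (b == z')) || ((a == z') && (b == z)).
Proof.
move=> zz'; apply/eqP/orP => [E|[] /andP[/eqP-> /eqP->] //]; last first.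
  by rewrite setUC.
have := set21 a b; have := set22 a b; rewrite E !inE.
have := set21 z z'; have := set22 z z'; rewrite -E !inE => z'ab zab.
case/orP=> /eqP bE /orP[] /eqP aE; move: z'ab zab; rewrite aE bE !eqxx.
- by rewrite orbb eq_sym (negPf zz').
- by right.
- by left.
- by rewrite orbb (negPf zz').
Qed.

(** Expand each square.  The [f a ^+ 2] terms, counted once per neighbour of
    [a], would give [k] times the sum for [e] itself; deleting [zz'] lowers the
    degrees of [z] and [z'] by one, hence the two subtracted squares.  The terms
    [f b ^+ 2] give the same total by symmetry, hence the factor 2.  Regularity is
    asked on the support of [f] only, so that [e] may live in a larger type than
    the vertex set of a regular graph. *)
Lemma energy_delete_edge {R : realFieldType} {U : finType} (e : rel U)
    (f : U -> R) (k : nat) z z' :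
  symmetric e -> z != z' -> e z z' ->
  (forall a, f a != 0 -> #|[set b | e a b]| = k) ->
  \sum_a \sum_b (delete_edge e [set z; z'] a b)%:R * (f a - f b) ^+ 2 =
  (k%:R * (\sum_a f a ^+ 2) - f z ^+ 2 - f z' ^+ 2 -
   \sum_a \sum_b (delete_edge e [set z; z'] a b)%:R * (f a * f b)) *+ 2.
Proof.
move=> sym_e zz' ezz' reg_e; set d := delete_edge e _.
have sym_d : symmetric d by exact: delete_edge_sym.
have dE a b : (d a b)%:R = (e a b)%:R - ((a == z) && (b == z'))%:R
    - ((a == z') && (b == z))%:R :> R.
  rewrite /d /delete_edge /= set2_eq //.
  case: (eqVneq a z) => [->|_] /=.
    rewrite (negPf zz') /= orbF; case: (eqVneq b z') => [->|_] /=.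
      by rewrite ezz' subrr subr0.
    by rewrite andbT !subr0.
  case: (eqVneq a z') => [->|_] /=; last by rewrite andbT !subr0.
  case: (eqVneq b z) => [->|_] /=; last by rewrite andbT !subr0.
  by rewrite sym_e ezz' !subr0 subrr.
have sumd : \sum_a \sum_b (d a b)%:R * f a ^+ 2 =
    k%:R * (\sum_a f a ^+ 2) - f z ^+ 2 - f z' ^+ 2.
  have pick (y y' : U) :
      \sum_a \sum_b ((a == y) && (b == y'))%:R * f a ^+ 2 = f y ^+ 2.
    rewrite (bigD1 y) //= (bigD1 y') //= !eqxx mul1r.
    rewrite big1 ?addr0 => [|b /negPf->]; last by rewrite andbF mul0r.
    rewrite big1 ?addr0 // => a /negPf->.
    by rewrite big1 // => b _; rewrite mul0r.
  rewrite -[in RHS](pick z z') -[in RHS](pick z' z) mulr_sumr -!sumrB.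
  apply: eq_bigr => a _.
  have -> : k%:R * f a ^+ 2 = \sum_b (e a b)%:R * f a ^+ 2.
    have [->|fa] := eqVneq (f a) 0.
      by rewrite expr0n mulr0 big1 // => b _; rewrite mulr0.
    rewrite -mulr_suml -(reg_e a fa) -sum1dep_card natr_sum big_mkcond /=.
    by congr (_ * _); apply: eq_bigr => b _; case: (e a b).
  by rewrite -!sumrB; apply: eq_bigr => b _; rewrite dE !mulrBl.
have sumd' : \sum_a \sum_b (d a b)%:R * f b ^+ 2 =
    k%:R * (\sum_a f a ^+ 2) - f z ^+ 2 - f z' ^+ 2.
  rewrite -sumd exchange_big /=.
  by apply: eq_bigr => a _; apply: eq_bigr => b _; rewrite sym_d.
rewrite mulrnBl mulr2n -{1}sumd -sumd' -sumrMnl -big_split -sumrB /=.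
apply: eq_bigr => a _; rewrite -sumrMnl -big_split -sumrB /=.
by apply: eq_bigr => b _; ring.
Qed.

(** * The two spectral estimates *)

Lemma adj_sym {U : finType} (G : graph U) : symmetric (adj G).
Proof. by move=> a b; rewrite /adj /= setUC. Qed.

Lemma adj_vertices {U : finType} (G : graph U) a b :
  adj G a b -> [/\ a != b, a \in vertices G & b \in vertices G].
Proof.
move=> ab; have /forall_inP/(_ _ ab)/andP[c2 /subsetP s] := edgesP G.
split; [|by apply: s; rewrite set21|by apply: s; rewrite set22].
by move: c2; rewrite cards2; case: (a != b).
Qed.

(** The all-ones vector is an eigenvector for the eigenvalue [k]. *)
Lemma degree_le_mu (R : rcfType) {U : finType} (G : graph U) (k : nat) :
  (forall x, x \in vertices G -> degree G x = k) -> k%:R <= mu R G.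
Proof.
move=> regG; have [_] := mu_correct R G; apply.
apply/eigenvalueP; exists (const_mx 1); last first.
  have /set0Pn[x xG] := vertices_neq0 G.
  apply/eqP => /rowP/(_ (enum_rank_in xG x)); rewrite !mxE => /eqP.
  by rewrite oner_eq0.
apply/rowP => j; rewrite !mxE mulr1.
have jG := enum_valP j; rewrite -(regG _ jG) /degree -sum1dep_card natr_sum.
transitivity (\sum_(i < graph_order G) (adj G (enum_val i) (enum_val j))%:R : R).
  by apply: eq_bigr => i _; rewrite !mxE mul1r.
rewrite -(big_enum_val (fun a => (adj G a (enum_val j))%:R)) /=.
rewrite big_mkcond [RHS]big_mkcond; apply: eq_bigr => a _ /=.
rewrite -/(adj G _ _) (adj_sym G).
have [aG|aNG] := boolP (a \in vertices G); first by case: (adj G _ a).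
by case: ifP => // /(adj_vertices G)[_ _]; rewrite (negPf aNG).
Qed.

(** Taking absolute values of an eigenvector can only increase its quadratic
    form, since adjacency matrices are nonnegative. *)
Lemma mu_test_function (R : rcfType) {U : finType} (H : graph U) :
  exists f : U -> R, [/\ forall a, 0 <= f a,
    forall a, f a != 0 -> a \in vertices H, exists a, f a != 0 &
    mu R H * (\sum_a f a ^+ 2) <= \sum_a \sum_b (adj H a b)%:R * (f a * f b)].
Proof.
have [/eigenvalueP[v vE v0] _] := mu_correct R H.
pose f a := \sum_(i | enum_val i == a) `|v 0 i|.
have fE i : f (enum_val i) = `|v 0 i|.
  by rewrite /f (eq_bigl (pred1 i)) ?big_pred1_eq // => j; rewrite (inj_eq enum_val_inj).
have f_supp a : f a != 0 -> a \in vertices H.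
  apply: contraNT => aNH; rewrite /f big_pred0 // => i.
  by apply: contraNF aNH => /eqP<-; apply: enum_valP.
have sumE (F : U -> R) : (forall a, f a = 0 -> F a = 0) ->
    \sum_a F a = \sum_(i < graph_order H) F (enum_val i).
  move=> F0; rewrite -(big_enum_val F) /= [RHS]big_mkcond; apply: eq_bigr => a _.
  by case: ifPn => // aNH; apply/F0/eqP; apply: contraNT aNH => /f_supp.
exists f; split=> //; first by move=> a; rewrite sumr_ge0.
  by have /rV0Pn[i vi] := v0; exists (enum_val i); rewrite fE normr_eq0.
rewrite sumE => [|a ->]; last by rewrite expr0n.
rewrite [leRHS]sumE => [|a fa]; last by rewrite big1 // => b _; rewrite fa mul0r mulr0.
rewrite mulr_sumr; apply: ler_sum => j _.
rewrite sumE => [|b ->]; last by rewrite !mulr0.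
have /rowP/(_ j) := vE; rewrite !mxE => vjE.
rewrite fE real_normK ?num_real // expr2 mulrA -vjE mulr_suml.
apply: ler_sum => i _; rewrite fE !mxE (adj_sym H) -mulrA mulrCA.
rewrite ler_wpM2l ?ler0n // mulrC -normrM.
exact: ler_norm.
Qed.

(** * Connectedness *)

Lemma has_path_diameter {U : finType} (G : graph U) x y :
  connected G -> x \in vertices G -> y \in vertices G ->
  exists p, [/\ path (adj G) x p, last x p = y, uniq (x :: p) &
                (size p <= diameter G)%N].
Proof.
move=> conG xG yG; have [k /dist_correct[/existsP[p]]] := conG x y xG yG.
case/and3P=> xp /eqP lp up _; exists p; split=> //.
rewrite size_tuple /diameter.
by apply: (bigop.bigmax_sup x) => //; apply: (bigop.bigmax_sup y).
Qed.

(** A vertex outside [H] lies on an edge of [G], which is then not in [H]. *)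
Lemma proper_subgraph_missing_edge {U : finType} (G H : graph U) :
  connected G -> proper_subgraph H G ->
  exists z z', [/\ adj G z z', z != z' & [set z; z'] \notin edges H].
Proof.
move=> conG /andP[/andP[sV sE]].
have [EE|NE _] := eqVneq (edges H) (edges G); last first.
  have /subsetPn[d dG dH] : ~~ (edges G \subset edges H).
    by apply: contra NE => sE'; rewrite eqEsubset sE.
  have /forall_inP/(_ _ dG)/andP[/cards2P[z [z' [zz' dE]]] _] := edgesP G.
  by exists z, z'; rewrite /adj /= -dE.
rewrite orbF => NV.
have /subsetPn[z zG zH] : ~~ (vertices G \subset vertices H).
  by apply: contra NV => sV'; rewrite eqEsubset sV.
have /set0Pn[y yH] := vertices_neq0 H.
have [[|z' p] [/= + zy _ _]] := has_path_diameter G z y conG zG (subsetP sV y yH).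
  by rewrite -zy (negPf zH) in yH.
case/andP=> zz' _; exists z, z'; split=> //; first by case: (adj_vertices G z z').
by apply: contra zH => /(adj_vertices H)[].
Qed.

(** * The spectral gap *)

(** Source of strictness: either [f z = 0] and the term at [z] falls short of
    [M], or the slack [c * f z ^+ 2] is positive. *)
Lemma sum_sqr_lt {R : realFieldType} {U : finType} (A : {set U}) (f : U -> R)
    (M c : R) z :
  (forall a, f a != 0 -> a \in A) -> (forall a, f a ^+ 2 <= M) ->
  0 < M -> 0 < c -> z \in A ->
  \sum_a f a ^+ 2 < #|A|%:R * (M + c * f z ^+ 2).
Proof.
move=> fA fM M0 c0 zA.
have -> : \sum_a f a ^+ 2 = \sum_(a in A) f a ^+ 2.
  rewrite [RHS]big_mkcond; apply: eq_bigr => a _; case: ifPn => // aA.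
  by apply/eqP; rewrite sqrf_eq0; apply: contraNT aA => /fA.
rewrite mulr_natl -sumr_const.
have c_ge0 : 0 <= c * f z ^+ 2 by rewrite mulr_ge0 ?sqr_ge0 // ltW.
rewrite (bigD1 z) //= [ltRHS](bigD1 z) //= ltr_leD //; last first.
  by apply: ler_sum => a _; rewrite (le_trans (fM a)) // lerDl.
have [->|fz] := eqVneq (f z) 0; first by rewrite expr0n mulr0 addr0.
rewrite (le_lt_trans (fM z)) // ltrDl mulr_gt0 //.
by rewrite lt_def sqrf_eq0 fz sqr_ge0.
Qed.

Theorem theorem4 (R : rcfType) (U : finType) (G H : graph U) :
  connected G -> regular G -> proper_subgraph H G ->
  mu R G - mu R H > 1 / ((graph_order G)%:R * ((diameter G)%:R + 1)).
Proof.
move=> conG [k regG] properH.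
have [y [y' [Gyy' yy' yy'H]]] := proper_subgraph_missing_edge G H conG properH.
have /andP[/andP[sV sE] _] := properH.
have [f [f_ge0 fH [a0 fa0] fmu]] := mu_test_function R H.
have fG a : f a != 0 -> a \in vertices G by move/fH/(subsetP sV).
(* A vertex where [f] is maximal; it is a vertex of [G] because [f w > 0]. *)
have [w [wG fw]] : exists w, w \in vertices G /\ forall a, f a <= f w.
  case: (@Order.TotalTheory.arg_maxP _ _ _ a0 predT f isT) => w _ fw.
  exists w; split=> [|a]; last exact: fw.
  apply: fG; rewrite gt_eqF // (lt_le_trans _ (fw a0 isT)) //.
  by rewrite lt_def fa0 f_ge0.
have [_ yG _] := adj_vertices G y y' Gyy'.
have [p [wp lp up sp]] := has_path_diameter G w y conG wG yG.
have [|q [/prefixP[r pE] wq lq]] := path_cut_at_edge _ [set y; y'] w p wp.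
  by rewrite lp set21.
have uq : uniq (w :: q) by move: up; rewrite pE -cat_cons cat_uniq => /andP[].
have sq : (size q <= diameter G)%N.
  by rewrite (leq_trans _ sp) // pE size_cat leq_addr.
(* Name [z] the end of the missing edge that the cut path reaches. *)
have [z [z' [lz zz' dE]]] : exists z z',
    [/\ last w q = z, z != z' & [set y; y'] = [set z; z']].
  move: lq; rewrite !inE => /orP[/eqP->|/eqP->]; first by exists y, y'.
  by exists y', y; rewrite eq_sym setUC.
rewrite dE in wq yy'H.
have Gzz' : adj G z z' by rewrite /adj /= -dE.
have [_ _ z'G] := adj_vertices G z z' Gzz'.
set e := delete_edge (adj G) [set z; z'] in wq.
have sym_e : symmetric e by exact/delete_edge_sym/adj_sym.
have He a b : adj H a b -> e a b.
  move=> ab; apply/andP; split; first exact: (subsetP sE).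
  by apply: contraNneq yy'H => <-.
have fe : mu R H * (\sum_a f a ^+ 2) <= \sum_a \sum_b (e a b)%:R * (f a * f b).
  apply: le_trans fmu _; apply: ler_sum => a _; apply: ler_sum => b _.
  rewrite ler_wpM2r ?mulr_ge0 // ler_nat.
  by have := He a b; case: (adj H a b) => // ->.
have energyE := energy_delete_edge (adj G) f k z z' (adj_sym G) zz' Gzz'
  (fun a fa => regG a (fG a fa)).
have := path_energy_le e f w q sym_e wq uq.
rewrite energyE -/e lerMn2r /= => Ple.
have := sqr_le_path_energy f w q; rewrite lz => fwle.
have P_ge0 : 0 <= path_energy f w q.
  by elim: (q) (w) => //= b s IH a; rewrite addr_ge0 ?sqr_ge0.
have := degree_le_mu R G k regG.
have D1 : 0 < (diameter G)%:R + 1 :> R by rewrite natr1 ltr0n.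
have fw2 a : f a ^+ 2 <= f w ^+ 2 by rewrite lerXn2r ?nnegrE.
have fa02 : 0 < f a0 ^+ 2 by rewrite lt_def sqrf_eq0 fa0 sqr_ge0.
have := sum_sqr_lt (vertices G) f (f w ^+ 2) _ z' fG fw2
  (lt_le_trans fa02 (fw2 a0)) D1 z'G.
have S0 : 0 < \sum_a f a ^+ 2.
  by rewrite (lt_le_trans fa02) // (bigD1 a0) //= lerDl sumr_ge0 // => a _; rewrite sqr_ge0.
have n0 : 0 < (graph_order G)%:R :> R by rewrite ltr0n card_gt0 vertices_neq0.
have fwD : f w ^+ 2 <=
    ((diameter G)%:R + 1) * (path_energy f w q + f z ^+ 2).
  apply: le_trans fwle _; rewrite ler_wpM2r ?addr_ge0 ?sqr_ge0 //.
  by rewrite natr1 ler_nat.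
rewrite -/(graph_order G) ltr_pdivrMr ?mulr_gt0 //.
move: (\sum_a f a ^+ 2) S0 fe Ple => S S0 fe Ple.
move: (graph_order G)%:R (_ + 1) D1 n0 fwD => n D D1 n0 fwD Slt kmu.
rewrite -(ltr_pM2l S0) mulr1 (lt_le_trans Slt) //.
have -> : S * ((mu R G - mu R H) * (n * D)) = n * (D * ((mu R G - mu R H) * S)).
  by ring.
rewrite ler_pM2l //.
have gap : path_energy f w q + f z ^+ 2 + f z' ^+ 2 <= (mu R G - mu R H) * S.
  have : k%:R * S <= mu R G * S by rewrite ler_pM2r.
  by rewrite mulrBl; lra.
rewrite (le_trans _ (ler_wpM2l (ltW D1) gap)) //.
by rewrite [leRHS]mulrDr lerD2r.
Qed.
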